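(* A locally precompact $T_0$ (equivalently, regular) topological group $X$ is metrizable if and only if $X$ contains a dense subgroup with the strong Pytkeev property.
   Context: A subset $A$ of a topological space $X$ accumulates at a point $x\in X$ if each neighborhood of $x$ contains infinitely many points of $A$. A topological space $X$ has the strong Pytkeev property at a point $x\in X$ if there is a countable family $\mathcal N$ of subsets of $X$ such that for every neighborhood $O_x\subset X$ of $x$ and every subset $A\subset X$ accumulating at $x$ there is a set $N\in\mathcal N$ such that $N\subset O_x$ and $N\cap A$ is infinite. $X$ has the strong Pytkeev property if it has it at each point $x\in X$. The subgroup carries the subspace topology. A topological lop is a topological space $L$ endowed with a continuous binary operation $L\times L\to L$, $(x,y)\mapsto xy$, which has a unit $e$ (that is, $xe=x=ex$ for all $x\in L$) and for which the map $L\times L\to L\times L$, $(x,y)\mapsto(x,xy)$, is a homeomorphism; every topological group is a topological lop. All topological lops here are assumed to be $T_0$ (equivalently, regular). A sublop of a topological lop is a subset which is a topological lop with respect to the restricted operation and the subspace topology. A topological lop (in particular, a topological group) is locally precompact if it is topologically isomorphic to a sublop of a locally compact topological lop. *)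

(* Defs.v *)
From HB Require Import structures.
From mathcomp Require Import all_boot all_order all_algebra.
From mathcomp Require Import all_classical all_reals.
From mathcomp Require Import topology.

Set Implicit Arguments.
Unset Strict Implicit.
Unset Printing Implicit Defensive.

Local Open Scope classical_set_scope.
Local Open Scope group_scope.

HB.structure Definition PreTopologicalGroup := {X of Topological X & Group X}.

HB.mixin Record PreTopologicalGroup_isTopologicalGroup X
    & PreTopologicalGroup X := {
  mulg_continuous : continuous (fun z : X * X => z.1 * z.2) ;
  invg_continuous : continuous (fun x : X => x^-1)
}.

#[short(type="topologicalGroupType")]
HB.structure Definition TopologicalGroup :=
  {X of PreTopologicalGroup X & PreTopologicalGroup_isTopologicalGroup X}.

Definition homeomorphism (T U : topologicalType) (f : T -> U) : Prop :=
  continuous f /\ exists g : U -> T, [/\ cancel f g, cancel g f & continuous g].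

Definition metrizable (R : realType) (T : topologicalType) : Prop :=
  exists (M : metricType R) (f : T -> M), homeomorphism f.

(* Coincides with [limit_point A x] in T1 spaces, but not in general. *)
Definition accumulating_at (T : topologicalType) (A : set T) (x : T) : Prop :=
  forall U : set T, nbhs x U -> infinite_set (U `&` A).

Definition strong_pytkeev_at (T : topologicalType) (x : T) : Prop :=
  exists2 N : set (set T), countable N &
    forall (O A : set T), nbhs x O -> accumulating_at A x ->
      exists B : set T, [/\ N B, B `<=` O & infinite_set (B `&` A)].

Definition strong_pytkeev (T : topologicalType) : Prop :=
  forall x : T, strong_pytkeev_at x.

(* The standing assumption that all topological lops are T0 is built in. *)
Definition topological_lop (T : topologicalType) (op : T -> T -> T) : Prop :=
  [/\ kolmogorov_space T,
      continuous (fun z : T * T => op z.1 z.2),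
      exists e : T, right_id e op /\ left_id e op &
      homeomorphism (fun z : T * T => (z.1, op z.1 z.2))].

Definition topologically_isomorphic (T U : topologicalType)
    (opT : T -> T -> T) (opU : U -> U -> U) : Prop :=
  exists2 f : T -> U, homeomorphism f & {morph f : x y / opT x y >-> opU x y}.

(* [opA], an operation on the subspace A, is the restriction of [op] to the
   subset A; its existence says that A is closed under [op]. *)
Definition restricted_op (T : topologicalType) (op : T -> T -> T) (A : set T)
    (opA : A -> A -> A) : Prop :=
  forall x y : A, set_val (opA x y) = op (set_val x) (set_val y).

Definition sublop (T : topologicalType) (op : T -> T -> T) (A : set T)
    (opA : A -> A -> A) : Prop :=
  restricted_op op opA /\ topological_lop opA.

Definition locally_precompact (T : topologicalType) (op : T -> T -> T) : Prop :=
  exists (L : topologicalType) (opL : L -> L -> L) (A : set L)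
         (opA : A -> A -> A),
    [/\ topological_lop opL, locally_compact [set: L], sublop opL opA &
        topologically_isomorphic op opA].

Definition subgroup (G : groupType) (H : set G) : Prop := group_closed [in H].

(* Main.v *)
Require Import Defs.
From HB Require Import structures.
From mathcomp Require Import all_boot all_order all_algebra.
From mathcomp Require Import all_classical all_reals.
From mathcomp Require Import topology urysohn.

Import Order.TTheory GRing.Theory Num.Theory.

(** A metrizable space is first countable, and a countable base at a point is a
    network witnessing the strong Pytkeev property there; the whole group is
    then the required dense subgroup.

    For the converse, let H be a dense subgroup with the strong Pytkeev property
    at 1, witnessed by sets B 0, B 1, and so on.  Local precompactness provides
    a neighbourhood W of 1 in which every sequence x_0, x_1, ... has pairs
    i < j with x_i^-1 x_j arbitrarily close to 1 ([locally_precompact_nbhs]).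
    Fix a neighbourhood O of 1.  Some finite union F of {1} and of members of
    the network lying in O is so large that finitely many left translates of F
    cover W meet H ([network_union_covers]): otherwise one chooses x_j in
    W meet H, step by step, so that x_i^-1 x_j avoids the j-th such union for
    all i < j.  The quotients x_i^-1 x_j with i < j accumulate at 1, while each
    member of the network lying in O contains only finitely many of them, which
    contradicts the strong Pytkeev property.

    As H is dense, finitely many translates of the closure of F cover the
    interior of W, hence the closure of F has an interior point, and its set of
    quotients x^-1 y is a neighbourhood of 1.  This neighbourhood is as small as
    desired when O is small.  There are only countably many finite unions F, so
    the group is first countable ([strong_pytkeev_countable_base]).

    Finally a first countable T0 group is metrizable ([group_metrizable], the
    Birkhoff-Kakutani theorem): its left uniformity has a countable base, so it
    is induced by a bounded pseudometric, which separates points because the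
    group is Hausdorff. *)

Local Open Scope classical_set_scope.
Local Open Scope group_scope.

(** * Neighbourhoods of the unit in a topological group *)

Section TopologicalGroup.
Context {X : topologicalGroupType}.
Implicit Types (x y : X) (U V : set X).

Lemma cvgMg (T : Type) (F : set_system T) (FF : Filter F) (f g : T -> X) x y :
  f @ F --> x -> g @ F --> y -> (fun t => f t * g t) @ F --> x * y.
Proof. by apply: continuous2_cvg; exact: (mulg_continuous (x, y)). Qed.

Lemma cvgVg (T : Type) (F : set_system T) (FF : Filter F) (f : T -> X) x :
  f @ F --> x -> (fun t => (f t)^-1) @ F --> x^-1.
Proof.
move=> fx.
exact: (cvg_comp f (fun x : X => x^-1) fx (@invg_continuous X x)).
Qed.

Lemma mulg_continuousl x : continuous (fun y : X => x * y).
Proof. by move=> y; apply: cvgMg; [exact: cvg_cst|exact: cvg_id]. Qed.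

Lemma nbhs_translate x U : nbhs 1 (fun y => U (x * y)) <-> nbhs x U.
Proof.
split=> [xU|].
  have := mulg_continuousl x^-1 x; rewrite /continuous_at mulVg => /(_ _ xU).
  by rewrite nbhs_simpl /=; apply: filterS => y /=; rewrite mulVKg.
rewrite -[in X in X -> _](mulg1 x) => xU.
exact: (mulg_continuousl x 1 _ xU).
Qed.

(** Continuity of both division maps at (1, 1), in the form in which it
    replaces a neighbourhood by a smaller one. *)
Lemma nbhs_divg U : nbhs (1 : X) U ->
  exists2 V, nbhs (1 : X) V &
    forall x y, V x -> V y -> U (x^-1 * y) /\ U (x / y).
Proof.
move=> U1.
have c1 : (fun z : X * X => z.1^-1 * z.2) z @[z --> ((1 : X), (1 : X))] -->
    (1 : X).
  rewrite -[X in _ --> X](mul1g 1) -{1}[X in _ --> X * _]invg1.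
  by apply: cvgMg; [apply: cvgVg; exact: cvg_fst|exact: cvg_snd].
have c2 : (fun z : X * X => z.1 / z.2) z @[z --> ((1 : X), (1 : X))] -->
    (1 : X).
  rewrite -[X in _ --> X](mul1g 1) -{1}[X in _ --> _ * X]invg1.
  by apply: cvgMg; [exact: cvg_fst|apply: cvgVg; exact: cvg_snd].
have [[A B] /= [A1 B1] AB] : nbhs ((1 : X), (1 : X))
    ((fun z => U (z.1^-1 * z.2)) `&` (fun z => U (z.1 / z.2))).
  by apply: filterI; [exact: c1|exact: c2].
exists (A `&` B); first exact: filterI.
by move=> x y [Ax Bx] [Ay By]; exact: (AB (x, y)).
Qed.

(** If y lies outside a neighbourhood A of x, then x V and y V are disjoint as
    soon as x V V^-1 is included in A.  As being separated is symmetric in x and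
    y, the T0 axiom provides such an A. *)
Lemma kolmogorov_hausdorff_group : kolmogorov_space X -> hausdorff_space X.
Proof.
move=> T0 x y xy; apply: contrapT => /eqP neq_xy.
wlog [A xA Ay] : x y xy {neq_xy} / exists2 A, nbhs x A & ~ A y.
  move=> W; have [A AP] := T0 _ _ neq_xy.
  case: AP => -[/set_mem xA /set_mem].
    by move=> Ay; apply: (W x y) => //; exists A.
  move=> Ax; apply: (W y x); last by exists A.
  by move=> C D yC xD; rewrite setIC; exact: xy.
have [V V1 VA] := nbhs_divg _ (iffRL (nbhs_translate x A) xA).
have tr z : nbhs z (fun w => V (z^-1 * w)).
  by apply/nbhs_translate; apply: filterS V1 => w Vw; rewrite /= mulKg.
have [z [xz yz]] := xy _ _ (tr x) (tr y).
have [_ /=] := VA _ _ xz yz.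
by rewrite mulgKA invgK mulVKg.
Qed.

End TopologicalGroup.

(** * Metrizability of first countable groups *)

(** A copy of the group, with the same topology, that carries the left
    uniformity. *)
Definition left_uniform (X : topologicalGroupType) : Type := X.

Section LeftUniformity.
Context (X : topologicalGroupType).
Local Open Scope relation_scope.

Definition left_entourage : set_system (X * X) :=
  filter_from (nbhs (1 : X)) (fun U => [set xy | U (xy.1^-1 * xy.2)]).

Let left_entourage_filter : Filter left_entourage.
Proof.
apply: filter_from_filter; first by exists setT; exact: filterT.
by move=> U V U1 V1; exists (U `&` V); first exact: filterI.
Qed.

Let left_entourage_diagonal A : left_entourage A -> diagonal `<=` A.
Proof.
move=> [U U1 UA] [x y]; rewrite /diagonal /= => <-; apply: UA => /=.
by rewrite mulVg; exact: nbhs_singleton.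
Qed.

Let left_entourage_inv A : left_entourage A -> left_entourage A^-1.
Proof.
move=> [U U1 UA]; have [V V1 VU] := nbhs_divg _ U1.
exists V => // -[x y] /= Vxy; apply: UA => /=.
have [+ _] := VU _ _ Vxy (nbhs_singleton V1).
by rewrite mulg1 invgM invgK.
Qed.

Let left_entourage_split A :
  left_entourage A -> exists2 B, left_entourage B & B \; B `<=` A.
Proof.
move=> [U U1 UA]; have [V V1 VU] := nbhs_divg _ U1.
have [W W1 WV] := nbhs_divg _ V1.
exists [set xy | W (xy.1^-1 * xy.2)]; first by exists W.
move=> [x y] [z /= Wxz Wzy]; apply: UA => /=.
have [+ _] := WV _ _ Wxz (nbhs_singleton W1); rewrite mulg1 => Vxz.
have [_ +] := WV _ _ Wzy (nbhs_singleton W1); rewrite divg1 => Vzy.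
have [+ _] := VU _ _ Vxz Vzy.
by rewrite invgK -mulgA mulVKg.
Qed.

Let nbhs_left_entourage : nbhs = nbhs_ left_entourage :> (X -> set_system X).
Proof.
apply/funext => x; apply/seteqP; split=> U.
  move=> /nbhs_translate xU; exists [set xy | U (x * (xy.1^-1 * xy.2))].
    by exists (fun y => U (x * y)).
  by move=> y /xsectionP /=; rewrite mulVKg.
move=> [E [V V1 VE] EU]; apply/nbhs_translate; apply: filterS V1 => y Vy.
by apply/EU/xsectionP/VE; rewrite /= mulKg.
Qed.

HB.instance Definition _ := Topological.copy (left_uniform X) X.
HB.instance Definition _ := Nbhs_isUniform_mixin.Build (left_uniform X)
  left_entourage_filter left_entourage_diagonal left_entourage_inv
  left_entourage_split nbhs_left_entourage.

End LeftUniformity.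

Section PseudoMetricMetrization.
Local Open Scope ring_scope.
Context (R : realType) (T : pseudoMetricType R).
Context (T_bounded : forall x y : T, exists2 r : R, 0 < r & ball x r y).
Context (T_hausdorff : hausdorff_space T).

(** The balls of a pseudometric type need not be the open balls of a distance.
    The infimum of the radii of the balls around x that contain y is a distance;
    boundedness makes it finite, and separation makes it definite. *)
Definition fine_edist (x y : T) : R := fine (@edist R T (x, y)).

Let edist_num x y : @edist R T (x, y) \is a fin_num.
Proof. exact/edist_finP. Qed.

Let fine_edistxx x : fine_edist x x = 0.
Proof. by rewrite /fine_edist edist_refl. Qed.

Let fine_edist_eq0 x y : fine_edist x y = 0 -> x = y.
Proof.
move=> xy; apply: close_eq => //; apply/edist_closeP.
by rewrite -(fineK (edist_num x y)) -/(fine_edist x y) xy.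
Qed.

Let fine_edistC x y : fine_edist x y = fine_edist y x.
Proof. by rewrite /fine_edist edist_sym. Qed.

Let fine_edist_triangle y x z :
  fine_edist x z <= fine_edist x y + fine_edist y z.
Proof.
by rewrite -lee_fin EFinD !fineK ?edist_num//; exact: edist_triangle.
Qed.

Let fine_edist_lt_ball x y r : fine_edist x y < r -> ball x r y.
Proof.
move=> xyr; apply: (@edist_lt_ball _ _ r (x, y)).
by rewrite -(fineK (edist_num x y)) lte_fin.
Qed.

Let ball_fine_edist_le x y r : 0 < r -> ball x r y -> fine_edist x y <= r.
Proof.
by move=> r0 xy; rewrite -lee_fin fineK ?edist_num//; exact: edist_fin.
Qed.

(** The carrier of the metric space is T with its topology forgotten, so that
    the structure built on it is the one generated by the distance; the identity
    is a homeomorphism because balls of radius r / 2 and r interleave. *)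
Lemma pseudometric_metrizable : metrizable R T.
Proof.
pose M : metricType R := HB.pack_for (metricType R) (T : Type)
  (Choice.class T) (isMetric.Build R T fine_edistxx fine_edist_eq0 fine_edistC
    fine_edist_triangle).
have ballM (x y : M) r : @ball R M x r y <-> fine_edist x y < r.
  by rewrite ballEmdist.
exists M, id; split; last exists id; last split => //.
- move=> x A /(@nbhs_ballP R M)[r /= r0 rA]; apply/(@nbhs_ballP R T).
  exists (r / 2) => /=; first exact: divr_gt0.
  move=> y xy; apply/rA/ballM.
  have r20 : 0 < r / 2 by exact: divr_gt0.
  apply: le_lt_trans (ball_fine_edist_le _ _ _ r20 xy) _.
  by rewrite ltr_pdivrMr// ltr_pMr// ltr1n.
- move=> x A /(@nbhs_ballP R T)[r /= r0 rA]; apply/(@nbhs_ballP R M).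
  by exists r => //= y /ballM/fine_edist_lt_ball; exact: rA.
Qed.

End PseudoMetricMetrization.

(** Birkhoff-Kakutani. *)
Lemma group_metrizable (R : realType) (X : topologicalGroupType)
    (B : nat -> set X) : kolmogorov_space X ->
    (forall n, nbhs 1 (B n)) ->
    (forall U, nbhs (1 : X) U -> exists n, B n `<=` U) ->
  metrizable R X.
Proof.
move=> T0 B1 baseB.
have cX : countable_uniformity (left_uniform X).
  apply/countable_uniformityP.
  exists (fun n => [set xy | B n (xy.1^-1 * xy.2)]).
    move=> A [U /baseB[n BU] UA]; exists n => xy /= /BU xyU.
    exact: UA.
  by move=> n; exists (B n).
apply: (@pseudometric_metrizable R (countable_uniform cX)).
  move=> x y; exists 2%R => //.
  exact: countable_uniform.countable_uniform_bounded.
exact: (@kolmogorov_hausdorff_group X).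
Qed.

(** * The strong Pytkeev property of subspaces *)

Lemma nbhs_set_typeP (T : topologicalType) (H : set T) (x : H) (U : set H) :
  nbhs x U <-> exists2 V, nbhs (set_val x) V & set_val @^-1` V `<=` U.
Proof.
split=> [|[V xV VU]]; last first.
  apply: filterS VU _; exact: (@initial_continuous _ _ (set_val : H -> T)).
rewrite nbhsE => -[_ [[V oV <-] xV] VU].
by exists V => //; exists V.
Qed.

Lemma countable_base_strong_pytkeev (T : topologicalType) (x : T)
    (B : nat -> set T) : (forall n, nbhs x (B n)) ->
    (forall U, nbhs x U -> exists n, B n `<=` U) ->
  strong_pytkeev_at x.
Proof.
move=> Bx baseB; exists (range B); first exact: card_image_le.
move=> O A /baseB[n BO] Ax; exists (B n); split => //.
exact: Ax.
Qed.

Lemma metrizable_countable_base (R : realType) (T : topologicalType) (x : T) :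
  metrizable R T -> exists B : nat -> set T, (forall n, nbhs x (B n)) /\
    (forall U, nbhs x U -> exists n, B n `<=` U).
Proof.
move=> [M [f [cf [g [fK gK cg]]]]].
exists (fun n => f @^-1` ball (f x) n.+1%:R^-1%R); split.
  by move=> n; apply: cf; apply: nbhsx_ballx; rewrite invr_gt0.
move=> U; rewrite -{1}(fK x) => /cg/nbhs_ballP[e /= e0 eU].
exists (Num.truncn e^-1%R) => y /= xy; rewrite -(fK y); apply: eU.
apply: le_ball xy.
rewrite -[leRHS]invrK lef_pV2 ?posrE ?invr_gt0//.
by rewrite ltW// truncnS_gt.
Qed.

(** Images under the inclusion of H turn a network of the subspace into one that
    consists of subsets of the ambient space, where closures and interiors can
    be taken. *)
Lemma strong_pytkeev_at_subspace (T : topologicalType) (H : set T) (x : H) :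
  strong_pytkeev_at x -> exists B : nat -> set T,
    forall O A : set T, nbhs (set_val x) O -> A `<=` H ->
      accumulating_at A (set_val x) ->
    exists n, B n `<=` O /\ infinite_set (B n `&` A).
Proof.
move=> [N cN NP].
have {}NP (O A : set T) : nbhs (set_val x) O -> A `<=` H ->
    accumulating_at A (set_val x) ->
    exists B, [/\ N B, set_val @` B `<=` O & infinite_set (set_val @` B `&` A)].
  move=> xO AH Ax.
  have [|U|B [NB BO BA]] := NP (set_val @^-1` O) (set_val @^-1` A).
  - by apply/nbhs_set_typeP; exists O.
  - move=> /nbhs_set_typeP[V xV VU]; have := Ax _ xV; apply: contra_not.
    move=> /(finite_image set_val); apply: sub_finite_set => y [Vy Ay].
    have Hy : y \in H by apply/mem_set/AH.
    exists (exist _ y Hy); last by rewrite set_valE.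
    by split; [apply: VU|]; rewrite /= set_valE.
  - exists B; split => //; first by move=> _ [y By <-]; exact: BO.
    apply: contra_not BA => fin.
    have inj : {in (set_val : H -> T) @^-1` (set_val @` B `&` A) &,
      injective (set_val : H -> T)} by move=> ? ? _ _ /val_inj.
    apply: sub_finite_set (finite_preimage inj fin) => y [By Ay].
    by split => //; exists y.
move: cN => /pfcard_geP[N0|/unsquash f].
  (* With an empty network, no set accumulates at x. *)
  exists (fun=> set0) => O A xO AH Ax.
  by have [B []] := NP _ _ xO AH Ax; rewrite N0.
exists (fun n => set_val @` f n) => O A xO AH Ax.
have [B [+ BO BA]] := NP _ _ xO AH Ax.
by move=> /(@surj _ _ _ _ f)[n _ fn]; exists n; rewrite fn.
Qed.

(** * Precompact neighbourhoods of the unit *)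

(** Total boundedness of W for the left uniformity, in its sequential form. *)
Definition left_precompact {X : topologicalGroupType} (W : set X) : Prop :=
  forall (x : nat -> X) (U : set X), (forall n, W (x n)) -> nbhs 1 U ->
  exists i j, (i < j)%N /\ U ((x i)^-1 * x j).

(** The division d is the second component of the inverse of
    (x, y) |-> (x, x y). *)
Lemma topological_lop_division (L : topologicalType) (op : L -> L -> L) :
  topological_lop op -> exists2 e : L, right_id e op &
    (exists2 d : L * L -> L, continuous d & forall x y, d (x, op x y) = y).
Proof.
move=> [_ _ [e [opxe _]] [_ [h [hK _ ch]]]]; exists e => //.
exists (snd \o h) => [z|x y]; last by rewrite /= (hK (x, y)).
apply: (@continuous_comp _ _ _ h snd); first exact: ch.
exact: cvg_snd.
Qed.

(** Let phi embed the group in a locally compact lop L.  A sequence whose image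
    stays in a compact neighbourhood of the unit of L has a cluster point z
    there.  The left division of L sends (z, z) to the unit, hence pairs of
    points close to z to points close to the unit, and it sends (phi x, phi y)
    to phi (x^-1 y). *)
Lemma locally_precompact_nbhs (X : topologicalGroupType) :
    locally_precompact (fun x y : X => x * y) ->
  exists2 W : set X, nbhs 1 W & left_precompact W.
Proof.
move=> [L [opL [A [opA [lopL lcL [restA _]]]]]].
move=> [f [cf [f' [fK f'K cf']]] fM].
have [e opxe [d cd dop]] := topological_lop_division _ _ lopL.
pose phi x : L := set_val (f x).
have phiM x y : phi (x * y) = opL (phi x) (phi y) by rewrite /phi fM restA.
have dphi x y : d (phi x, phi y) = phi (x^-1 * y).
  by rewrite -{1}(mulVKg x y) phiM dop.
(* phi 1 is idempotent, and the unit is the only idempotent since L has left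
   cancellation. *)
have phi1 : phi 1 = e.
  by rewrite -(dop (phi 1) (phi 1)) -phiM mulg1 -{2}(opxe (phi 1)) dop.
have cphi : continuous phi.
  move=> x; apply: (@continuous_comp _ _ _ f set_val); first exact: cf.
  exact: (@initial_continuous _ _ (set_val : A -> L)).
have phiV U : nbhs 1 U -> exists2 V, nbhs e V & phi @^-1` V `<=` U.
  move=> U1; have : nbhs (f 1) (f' @^-1` U) by apply: cf'; rewrite fK.
  move=> /nbhs_set_typeP[V fV VU]; exists V; first by rewrite -phi1.
  by move=> x Vx; rewrite -(fK x); exact: VU.
have [K eK [cK _]] := lcL e I.
exists (phi @^-1` K).
  apply: cphi; rewrite phi1; move: eK; rewrite /within /=.
  by apply: filterS => y; exact.
move=> x U Kx /phiV[V eV VU].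
have [|z [Kz clz]] := cK ((phi \o x) @ \oo) _ _.
  by exists 0%N => // n _; exact: Kx.
have dzz : d (z, z) = e by rewrite -{2}(opxe z) dop.
have [[P Q] /= [zP zQ] PQ] : nbhs (z, z) (d @^-1` V) by apply: cd; rewrite dzz.
have hit n : exists2 i, (n <= i)%N & (P `&` Q) (phi (x i)).
  have /clz : ((phi \o x) @ \oo) [set phi (x i) | i in [set i | (n <= i)%N]].
    by exists n => // i /= ni; exists i.
  by move=> /(_ _ (filterI zP zQ))[_ [[i ni <-] PQi]]; exists i.
have [i _ [Pi _]] := hit 0%N; have [j ij [_ Qj]] := hit i.+1.
exists i, j; split => //; apply: VU; rewrite /= -dphi.
exact: (PQ (phi (x i), phi (x j))).
Qed.

(** * Metrizability from the strong Pytkeev property *)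

(** By induction on the number of closed sets: either the first one contains the
    open set, or removing it leaves a smaller nonempty open set whose trace on
    the dense set is covered by the others. *)
Lemma dense_closed_cover (I : eqType) (X : topologicalType) (H W : set X)
    (C : I -> set X) (s : seq I) :
    dense H -> open W -> W !=set0 -> (forall i, closed (C i)) ->
    (forall x, W x -> H x -> exists2 i, i \in s & C i x) ->
  exists i W', [/\ open W', W' !=set0 & W' `<=` C i].
Proof.
move=> dH + + cC; elim: s W => [|i s IH] W oW W0 WC.
  have [x [Wx Hx]] := dH _ W0 oW.
  by have [] := WC _ Wx Hx.
have [WD0|/set0P WD0] := eqVneq (W `\` C i) set0.
  exists i, W; split => // x Wx; apply: contrapT => nCx.
  by have : set0 x by rewrite -WD0.
apply: (IH (W `\` C i)) => // [|x [Wx nCx] Hx].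
  by apply: openI => //; exact: closed_openC.
have [j] := WC _ Wx Hx; rewrite inE => /orP[/eqP -> //|js] Cx.
by exists j.
Qed.

Lemma closure_translate (X : topologicalGroupType) (x : X) (F : set X) :
  closed [set y | closure F (x^-1 * y)].
Proof.
apply: (@closed_comp _ _ (fun y => x^-1 * y)) => [y _|].
  exact: mulg_continuousl.
exact: closed_closure.
Qed.

(** Passing to closures costs nothing: if V is small, then the closure of any
    subset of a small enough O lies in O O^-1, hence in V. *)
Lemma closure_divg (X : topologicalGroupType) (U : set X) : nbhs 1 U ->
  exists2 O : set X, nbhs 1 O & forall F x y, F `<=` O ->
    closure F x -> closure F y -> U (x^-1 * y).
Proof.
move=> U1; have [V V1 VU] := nbhs_divg _ U1.
have [O O1 OV] := nbhs_divg _ V1; exists O => // F x y FO.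
have clV z : closure F z -> V z.
  move=> clz; have zO : nbhs z (fun w => O (z^-1 * w)).
    by apply/nbhs_translate; apply: filterS O1 => w Ow; rewrite /= mulKg.
  have [w [/FO Fw zw]] := clz _ zO.
  by have [_] := OV _ _ Fw zw; rewrite invgM invgK mulVKg.
by move=> /clV Vx /clV Vy; have [] := VU _ _ Vx Vy.
Qed.

Section StrongPytkeevGroup.
Context {X : topologicalGroupType} (H W : set X) (B : nat -> set X).
Context (T0 : kolmogorov_space X) (groupH : subgroup H) (denseH : dense H).
Context (nbhsW : nbhs 1 W) (precompactW : left_precompact W).
Context (pytkeevB : forall O A : set X, nbhs 1 O -> A `<=` H ->
  accumulating_at A 1 -> exists n, B n `<=` O /\ infinite_set (B n `&` A)).

(** The point 1 is included in order that quotients x_i^-1 x_j that avoid these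
    unions differ from 1: otherwise they could be close to 1 without
    accumulating there. *)
Definition network_union (s : seq nat) : set X :=
  1 |` \bigcup_(k in [set` s]) B k.

(** If no such finite union covers W meet H by finitely many translates, a
    recursive choice gives a sequence in W meet H whose quotients contradict the
    strong Pytkeev property. *)
Lemma network_union_covers (O : set X) : nbhs 1 O ->
  exists s, network_union s `<=` O /\ exists xs : seq X,
    forall y, W y -> H y -> exists2 x, x \in xs & network_union s (x^-1 * y).
Proof.
move=> O1; apply: contrapT => nocover.
(* The first n indices of the network, restricted to the members inside O. *)
pose s n := [seq k <- iota 0 n | `[< B k `<=` O >]].
have sO n : network_union (s n) `<=` O.
  move=> y [->|[k /=]]; first exact: nbhs_singleton.
  by rewrite mem_filter => /andP[/asboolP BO _]; exact: BO.
have /choice[next nextP] (xs : seq X) : exists y, [/\ W y, H y &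
    forall x, x \in xs -> ~ network_union (s (size xs)) (x^-1 * y)].
  apply: contrapT => nxs; apply: nocover; exists (s (size xs)); split => //.
  exists xs => y Wy Hy; apply: contrapT => ny; apply: nxs.
  exists y; split => //.
  by move=> x xxs Nxy; apply: ny; exists x.
(* L n lists the terms chosen before step n, so that x n avoids the translates
   of the n-th union by all of them. *)
pose L n := iter n (fun xs => next xs :: xs) [::].
have sizeL n : size (L n) = n by elim: n => //= n ->.
pose x n := next (L n).
have xL i j : (i < j)%N -> x i \in L j.
  elim: j => // j IH; rewrite ltnS leq_eqVlt => /orP[/eqP ->|/IH ij] /=.
    by rewrite mem_head.
  by rewrite in_cons ij orbT.
have Wx n : W (x n) by have [] := nextP (L n).
have Hx n : H (x n) by have [] := nextP (L n).
have xN i j : (i < j)%N -> ~ network_union (s j) ((x i)^-1 * x j).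
  by move=> /xL ij; have [_ _ /(_ _ ij)] := nextP (L j); rewrite sizeL.
pose A := [set z | exists i j, (i < j)%N /\ z = (x i)^-1 * x j].
have AH : A `<=` H.
  move=> _ [i [j [_ ->]]]; apply/set_mem.
  apply: (group_closedM groupH); last exact/mem_set.
  by apply: (group_closedV groupH); exact/mem_set.
have nA1 : ~ A 1 by move=> [i [j [ij E]]]; apply: (xN _ _ ij); left.
(* If U met A in a finite set, removing it from U would leave a neighbourhood of
   1 that misses A, against the precompactness of W. *)
have accA : accumulating_at A 1.
  move=> U U1 finUA.
  have clUA : closed (U `&` A).
    have /accessible_finite_set_closed/(_ _ finUA) // : accessible_space X.
    by apply: hausdorff_accessible; exact: kolmogorov_hausdorff_group.
  have V1 : nbhs 1 (U `&` ~` (U `&` A)).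
    apply: filterI => //; apply: open_nbhs_nbhs.
    by split; [exact: closed_openC|move=> []].
  have [i [j [ij [Uij]]]] := precompactW x _ Wx V1.
  by apply; split => //; exists i, j.
(* B n is part of the j-th union for all j > n, so B n contains x i^-1 x j only
   if i < j <= n. *)
have [n [BO]] := pytkeevB _ _ O1 AH accA; apply.
pose q (p : nat * nat) := (x p.1)^-1 * x p.2.
apply: (@sub_finite_set _ _ (q @` (`I_n.+1 `*` `I_n.+1))); last first.
  by apply: finite_image; apply: finite_setX; exact: finite_II.
move=> z [Bz [i [j [ij E]]]]; exists (i, j); last by rewrite E.
have jn : (j < n.+1)%N.
  rewrite ltnNge; apply/negP => nj; apply: (xN _ _ ij); right; exists n.
    by rewrite /= mem_filter mem_iota nj leq0n !andbT; exact/asboolP.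
  by rewrite -E.
by split => //=; exact: ltn_trans jn.
Qed.

Definition network_divg (s : seq nat) : set X :=
  [set z | exists x y, [/\ closure (network_union s) x,
    closure (network_union s) y & z = x^-1 * y]].

(** Let the closure of some translate a F contain a nonempty open set V, and let
    v be a point of V.  A point z of the neighbourhood v^-1 V of 1 is the quotient
    of a^-1 v and a^-1 v z, which lie in the closure of F. *)
Lemma network_divg_base (U : set X) : nbhs 1 U ->
  exists s, nbhs 1 (network_divg s) /\ network_divg s `<=` U.
Proof.
move=> U1; have [O O1 OU] := closure_divg _ _ U1.
have [s [sO [xs cover]]] := network_union_covers _ O1.
exists s; split; last by move=> _ [x [y [cx cy ->]]]; exact: OU sO cx cy.
pose C x := [set y | closure (network_union s) (x^-1 * y)].
have [|y /interior_subset Wy Hy|a [V [oV [v Vv] VC]]] :=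
    dense_closed_cover _ _ _ _ C xs denseH (open_interior W) _
      (fun x => closure_translate _ x _).
- by exists 1.
- by have [x xxs Nxy] := cover _ Wy Hy; exists x => //; exact: subset_closure.
have : nbhs v V by exact: open_nbhs_nbhs.
move=> /nbhs_translate; apply: filterS => z Vvz.
exists (a^-1 * v), (a^-1 * (v * z)); split; [exact: VC|exact: VC|].
by rewrite invgM invgK -mulgA mulVKg mulKg.
Qed.

Lemma strong_pytkeev_countable_base : exists D : nat -> set X,
  (forall n, nbhs 1 (D n)) /\
  (forall U, nbhs (1 : X) U -> exists n, D n `<=` U).
Proof.
pose D n : set X := if unpickle n is Some s then
  if pselect (nbhs 1 (network_divg s)) then network_divg s else setT else setT.
exists D; split=> [n|U /network_divg_base[s [s1 sU]]].
  rewrite /D; case: (unpickle n) => [s|]; last exact: filterT.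
  by case: pselect => //= _; exact: filterT.
by exists (pickle s); rewrite /D pickleK; case: pselect.
Qed.

End StrongPytkeevGroup.

Theorem corollary5p9 (R : realType) (X : topologicalGroupType)
  (T0X : kolmogorov_space X)
  (lpX : locally_precompact (fun x y : X => x * y)) :
  metrizable R X <->
  exists H : set X, [/\ subgroup H, dense H & strong_pytkeev H].
Proof.
split=> [mX|[H [groupH denseH pytkeevH]]].
  exists setT; split.
  - by split=> [|x y _ _]; rewrite inE.
  - by move=> O [x Ox] _; exists x; rewrite setIT.
  - move=> x.
    have [B [Bx baseB]] := metrizable_countable_base _ _ (set_val x) mX.
    apply: (countable_base_strong_pytkeev _ _ (fun n => set_val @^-1` B n)).
      by move=> n; apply/nbhs_set_typeP; exists (B n).
    move=> U /nbhs_set_typeP[V /baseB[n BV] VU]; exists n.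
    by apply: subset_trans VU => y; exact: BV.
have [W W1 precompactW] := locally_precompact_nbhs _ lpX.
have H1 : (1 : X) \in H by have [] := groupH.
have [B BP] := strong_pytkeev_at_subspace _ _ (exist _ (1 : X) H1) (pytkeevH _).
have [|D [D1 baseD]] :=
    strong_pytkeev_countable_base H W B T0X groupH denseH W1 precompactW.
  by move: BP; rewrite set_valE.
exact: group_metrizable T0X D1 baseD.
Qed.
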